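(* Let $h\ge1$, $\omega=e^{2\pi\mathrm{i}/h}$, and consider walks with steps in $\{0,\pm1,\dots,\pm h\}$. For $k\ge1$ and $n\ge0$, the number of positive walks of length $n$ from the origin to altitude $k$ (walks $0=y_0,\dots,y_n=k$ with $y_i\ge1$ for $1\le i\le n$) and the number of positive meanders of length $n$ (walks $0=y_0,\dots,y_n$ with $y_i\ge1$ for $1\le i\le n$) are respectively $$[z^n]G_{0,k}(z)=\sum_{n_1+\dots+n_h=nh}\ \sum_{i_1+\dots+i_h=k}\ \prod_{j=1}^h\frac{i_j}{n_j}\binom{n_j/h}{n_j-i_j}_{2h+1}\ \omega^{\sum_{j=1}^h(j-1)n_j},$$ $$[z^n]M_{>0}(z)=\sum_{n_1+\dots+n_h=nh}\ \sum_{i_1,\dots,i_h\ge0}\ \prod_{j=1}^h\frac{i_j}{n_j}\binom{n_j/h}{n_j-i_j}_{2h+1}\ \omega^{\sum_{j=1}^h(j-1)n_j},$$ where all $n_j,i_j$ range over nonnegative integers.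
   Context: For real $\alpha$, integer $m\ge1$ and integer $k$, $\binom{\alpha}{k}_m:=[u^k](1+u+\dots+u^{m-1})^{\alpha}$ (formal power series with constant term $1$; $0$ for $k<0$). In the products, the factor $\frac{i}{n}\binom{n/h}{n-i}_{2h+1}$ stands for $[z^n]U^i(z)$, where $U(z)=z+\cdots$ is the power series root of $1-z^h(U^{-h}+\dots+U^{h})=0$; concretely it equals $1$ if $i=n=0$ and $0$ if exactly one of $i,n$ is $0$. *)

(* Defs.v *)
From mathcomp Require Import all_boot all_order all_algebra.
From mathcomp Require Import reals trigo.
From mathcomp Require Import complex.
Set Implicit Arguments. Unset Strict Implicit. Unset Printing Implicit Defensive.
Import Order.TTheory GRing.Theory Num.Theory.
Local Open Scope ring_scope.

(* A walk of length n with steps in {-h,...,h} is encoded by its step sequence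
   s : 'I_n -> 'I_(2h+1), the actual j-th step being (s j) - h. *)
Definition step (h : nat) (x : 'I_(2 * h).+1) : int := (x : nat)%:Z - h%:Z.

Definition altitude (h n : nat) (s : {ffun 'I_n -> 'I_(2 * h).+1}) (i : nat) : int :=
  \sum_(j < n | (j < i)%N) step (s j).

Definition positive_walk (h n : nat) (s : {ffun 'I_n -> 'I_(2 * h).+1}) : bool :=
  [forall i : 'I_n.+1, (0 < i)%N ==> (1 <= altitude s i)].

Definition num_pos_walks (h n : nat) (k : int) : nat :=
  #|[set s : {ffun 'I_n -> 'I_(2 * h).+1} | positive_walk s && (altitude s n == k)]|.

Definition num_pos_meanders (h n : nat) : nat :=
  #|[set s : {ffun 'I_n -> 'I_(2 * h).+1} | positive_walk s]|.

Definition gbinom (R : fieldType) (alpha : R) (r : nat) : R :=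
  (\prod_(i < r) (alpha - i%:R)) / (r`!)%:R.

(* (1 + u + ... + u^(m-1))^alpha := sum_r gbinom alpha r * (u + ... + u^(m-1))^r,
   the standard formal power series with constant term 1; its coefficient of u^k
   (0 for k < 0).  Only r <= k contributes to [u^k]. *)
Definition binomm (R : fieldType) (alpha : R) (m : nat) (k : int) : R :=
  match k with
  | Posz k' => \sum_(r < k'.+1)
                 gbinom alpha r * ((\sum_(1 <= j < m) 'X^j : {poly R}) ^+ r)`_k'
  | Negz _ => 0
  end.

Definition ufactor (R : fieldType) (h i n : nat) : R :=
  if (i == 0%N) && (n == 0%N) then 1
  else if (i == 0%N) || (n == 0%N) then 0
  else (i%:R / n%:R) * binomm (n%:R / h%:R) (2 * h).+1 (n%:Z - i%:Z).

Definition omega (R : realType) (h : nat) : R[i] :=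
  Complex (cos (2 * pi / h%:R)) (sin (2 * pi / h%:R)).

(* Main.v *)
(** The kernel method.  Put z = t^h.  The kernel equation u^h = t^h (1 + u + ... + u^(2h)) is
    solved by U(w^j t), 0 <= j < h, where U = t psi(U)^(1/h) and psi(u) = 1 + u + ... + u^(2h);
    Lagrange inversion expands the powers of U.  After division by t, these h roots V_j have
    invertible pairwise differences, so the kernel is divisible by the product of the
    corresponding linear factors.  Reading this off the generating function of the complete
    symmetric polynomials h_k shows that t^k h_k(V) obeys the recurrence, obtained by removing the
    last step, that determines the generating function of the positive walks ending at k.
    Everything takes place in K[t]/(t^(N+1)) with N large enough. *)
From HB Require Import structures.
Require Import Defs.
From mathcomp Require Import all_boot all_order all_algebra.
From mathcomp Require Import reals trigo.
From mathcomp Require Import complex.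
From mathcomp Require Import ring lra zify.
Set Implicit Arguments. Unset Strict Implicit. Unset Printing Implicit Defensive.
Import Order.TTheory GRing.Theory Num.Theory.
Local Open Scope ring_scope.

Lemma coefXderiv (R : nzRingType) (p : {poly R}) n :
  ('X * p^`())`_n = p`_n *+ n.
Proof. by rewrite coefXM coef_deriv; case: n. Qed.

(** * Power series modulo t^(N+1) *)

Definition tseries (K : fieldType) (N : nat) : Type := {poly %/ ('X^(N.+1) : {poly K})}.
HB.instance Definition _ K N := GRing.ComUnitRing.on (tseries K N).

Definition tser {K : fieldType} N (p : {poly K}) : tseries K N := in_qpoly _ p.
HB.instance Definition _ K N := GRing.RMorphism.copy (@tser K N) (in_qpoly ('X^(N.+1) : {poly K})).

Definition tcoef {K : fieldType} {N : nat} (i : nat) (a : tseries K N) : K := (polyn a)`_i.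

Section Truncation.
Variables (K : fieldType) (N : nat).
Implicit Types (p q : {poly K}) (a b : tseries K N).

Lemma tcoef_tser p i : tcoef i (tser N p) = if (i <= N)%N then p`_i else 0.
Proof.
rewrite /tcoef /tser /in_qpoly /= mk_monic_Xn -Pdiv.IdomainMonic.modpE ?monicXn //.
by rewrite -Pdiv.IdomainMonic.take_poly_modp coef_take_poly.
Qed.

Fact tcoef_is_zmod_morphism i : zmod_morphism (@tcoef K N i).
Proof. by move=> a b; rewrite /tcoef /= coefB. Qed.
HB.instance Definition _ i :=
  GRing.isZmodMorphism.Build (tseries K N) K (tcoef i) (tcoef_is_zmod_morphism i).

Lemma tseriesP a b : (forall i, (i <= N)%N -> tcoef i a = tcoef i b) <-> a = b.
Proof.
split=> [e | -> //]; apply/val_inj/polyP => i; have [/e //|lt_Ni] := leqP i N.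
have sz (c : tseries K N) : (size (polyn c) <= N.+1)%N.
  by apply: leq_trans (size_npoly c) _; rewrite mk_monic_Xn size_polyXn.
by rewrite !nth_default // (leq_trans (sz _)).
Qed.

Lemma tserP p q :
  tser N p = tser N q <-> forall i, (i <= N)%N -> p`_i = q`_i.
Proof.
rewrite -tseriesP; split=> e i le_iN; have := e i le_iN; rewrite !tcoef_tser le_iN //.
Qed.

Lemma tser_surj a : exists p, a = tser N p.
Proof.
by exists (polyn a); apply/tseriesP => i le_iN; rewrite tcoef_tser le_iN.
Qed.

Lemma tserM p q : tser N (p * q) = tser N p * tser N q.
Proof. exact: rmorphM. Qed.

Lemma tserXn_eq0 : tser N ('X : {poly K}) ^+ N.+1 = 0.
Proof.
rewrite -rmorphXn -(rmorph0 (@tser K N)); apply/tserP => i le_iN.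
by rewrite coefXn coef0 ltn_eqF.
Qed.

Lemma tcoefXnM d n a : (d + n <= N)%N -> tcoef (d + n) (tser N 'X ^+ d * a) = tcoef n a.
Proof.
have [p ->] := tser_surj a; move=> le_N.
rewrite -rmorphXn -rmorphM !tcoef_tser le_N coefXnM ltnNge leq_addr addKn.
by rewrite (leq_trans (leq_addl _ _) le_N).
Qed.

(** Substituting ['X * y], which has no constant term, sends every term of degree above N to a
    multiple of ['X^(N.+1)]. Identities between truncated binomial series therefore survive the
    substitution. *)
Lemma tser_comp p q (y : {poly K}) :
  tser N p = tser N q -> tser N (p \Po ('X * y)) = tser N (q \Po ('X * y)).
Proof.
move=> e; rewrite -[p](poly_take_drop N.+1) -[q](poly_take_drop N.+1).
have -> : take_poly N.+1 p = take_poly N.+1 q.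
  by apply/polyP => i; rewrite !coef_take_poly ltnS; case: ifP => // /((tserP _ _).1 e).
rewrite !(comp_polyD, comp_polyM, comp_Xn_poly, rmorphD, rmorphM, rmorphXn, exprMn) /=.
by rewrite tserXn_eq0 !mul0r !mulr0.
Qed.

Lemma tseries_unit a : tcoef 0 a != 0 -> a \is a GRing.unit.
Proof.
move=> a0; suff coX q : q`_0 != 0 -> coprimep (mk_monic ('X^(N.+1) : {poly K})) q.
  exact: (coX (polyn a)).
move=> q0; rewrite mk_monic_Xn coprimep_expl // coprimep_sym.
by rewrite -['X]subr0 coprimep_XsubC rootE horner_coef0.
Qed.

End Truncation.

(** * Generalized binomial coefficients *)

Section GeneralizedBinomial.
Variable K : numFieldType.

Lemma gbinom0 (a : K) : gbinom a 0 = 1.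
Proof. by rewrite /gbinom big_ord0 fact0 divr1. Qed.

Lemma gbinomS (a : K) r : r.+1%:R * gbinom a r.+1 = a * gbinom (a - 1) r.
Proof.
rewrite /gbinom big_ord_recl factS natrM /= subr0.
under eq_bigr do rewrite /bump /= -natr1 addrC opprD -addrA [- 1 + a]addrC addrC.
have r1 : r.+1%:R != 0 :> K by rewrite pnatr_eq0.
have r2 : (r`!)%:R != 0 :> K by rewrite pnatr_eq0 -lt0n fact_gt0.
under eq_bigr do rewrite addrC.
by field; rewrite r2 nat1r.
Qed.

(** Induction on s: multiply by s + 1 = r + (s + 1 - r) and absorb each part into its own binomial
    by [gbinomS]. The two sums have the shape of the induction hypothesis, with weights a and b. *)
Lemma gbinom_vandermonde (a b : K) s :
  \sum_(r < s.+1) gbinom a r * gbinom b (s - r) = gbinom (a + b) s.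
Proof.
elim: s a b => [|s IHs] a b; first by rewrite big_ord1 !gbinom0 mulr1.
apply: (@mulfI _ s.+1%:R); first by rewrite pnatr_eq0.
rewrite gbinomS mulr_sumr.
transitivity (\sum_(r < s.+2) (r%:R * gbinom a r) * gbinom b (s.+1 - r)
  + \sum_(r < s.+2) gbinom a r * ((s.+1 - r)%:R * gbinom b (s.+1 - r))).
  rewrite -big_split; apply: eq_bigr => r _ /=.
  by rewrite -{1}(@subnKC r s.+1) -1?ltnS // natrD; ring.
transitivity (a * gbinom (a - 1 + b) s + b * gbinom (a + (b - 1)) s); last first.
  by rewrite addrAC addrA mulrDl.
congr (_ + _); rewrite -IHs mulr_sumr.
  rewrite big_ord_recl mulr0n !mul0r add0r; apply: eq_bigr => r _.
  by rewrite subSS gbinomS -mulrA.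
rewrite big_ord_recr /= subnn mulr0n mul0r mulr0 addr0; apply: eq_bigr => r _.
by rewrite subSn -1?ltnS // gbinomS mulrCA.
Qed.

Lemma gbinom_ge2 r : (1 < r)%N -> gbinom (1 : K) r = 0.
Proof.
case: r => [|[|r]] // _; rewrite /gbinom 2!big_ord_recl /= subrr.
by rewrite mul0r mulr0 mul0r.
Qed.

End GeneralizedBinomial.

(** * Lagrange inversion and the small roots of the kernel *)

Section LagrangeInversion.
Variables (K : numFieldType) (h N : nat).
Hypothesis h_gt0 : (0 < h)%N.
Local Notation tser := (@tser K N).

(** Chosen so that psi = 1 + X y; powers of psi are then binomial series in X y. *)
Let y : {poly K} := \sum_(j < 2 * h) 'X^j.

(* psi^a modulo X^(N+1). *)
Definition psi_pow (a : K) : {poly K} := (\poly_(r < N.+1) gbinom a r) \Po ('X * y).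

Lemma sum_expXS : \sum_(1 <= j < (2 * h).+1) 'X^j = 'X * y.
Proof.
by rewrite big_add1 /= big_mkord mulr_sumr; apply: eq_bigr => j _; rewrite exprS.
Qed.

Lemma coef_psi_pow a k :
  (k <= N)%N -> (psi_pow a)`_k = binomm a (2 * h).+1 k%:Z.
Proof.
move=> le_kN; rewrite /binomm sum_expXS /psi_pow poly_def raddf_sum coef_sum /=.
rewrite (big_ord_widen N.+1 (fun r => gbinom a r * (('X * y) ^+ r)`_k)) //.
rewrite [RHS]big_mkcond; apply: eq_bigr => r _ /=.
rewrite comp_polyZ comp_Xn_poly coefZ ltnS; case: leqP => // lt_kr.
by rewrite exprMn coefXnM lt_kr mulr0.
Qed.

Lemma coef0_psi_pow a : (psi_pow a)`_0 = 1.
Proof.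
by rewrite coef_psi_pow //= big_ord1 gbinom0 mul1r expr0 coef1.
Qed.

Lemma psi_powD a b : tser (psi_pow a * psi_pow b) = tser (psi_pow (a + b)).
Proof.
rewrite /psi_pow -comp_polyM; apply: tser_comp; apply/tserP => i le_iN.
rewrite coefM coef_poly ltnS le_iN -gbinom_vandermonde; apply: eq_bigr => r _.
have le_rN : (r <= N)%N by apply: leq_trans le_iN; rewrite -ltnS.
by rewrite !coef_poly !ltnS le_rN (leq_trans (leq_subr _ _) le_iN).
Qed.

Lemma psi_pow0 : psi_pow 0 = 1.
Proof.
rewrite /psi_pow; have -> : \poly_(r < N.+1) gbinom (0 : K) r = 1.
  apply/polyP => -[|i]; rewrite coef_poly coef1 /= ?gbinom0 //.
  by rewrite /gbinom big_ord_recl /= subrr !mul0r if_same.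
exact: comp_polyC.
Qed.

Lemma psi_pow1 : tser (psi_pow 1) = tser (\sum_(i < (2 * h).+1) 'X^i).
Proof.
rewrite /psi_pow; have -> : \sum_(i < (2 * h).+1) 'X^i = (1 + 'X) \Po ('X * y).
  rewrite comp_polyD comp_polyX comp_polyC -sum_expXS big_ord_recl expr0.
  by rewrite big_add1 big_mkord.
apply: tser_comp; apply/tserP => -[|[|i]] le_iN; rewrite coef_poly coefD coef1 coefX ltnS le_iN.
- by rewrite gbinom0 addr0.
- by rewrite add0r /gbinom big_ord1 subr0 [LHS]divr1.
- by rewrite gbinom_ge2 // addr0.
Qed.

Lemma psi_powMn a n : tser (psi_pow a) ^+ n = tser (psi_pow (a *+ n)).
Proof.
elim: n => [|n IHn]; first by rewrite psi_pow0 rmorph1.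
by rewrite exprS IHn -rmorphM /= psi_powD mulrS.
Qed.

Lemma Xderiv_psi_pow a :
  tser ('X * (psi_pow a)^`()) = tser (a *: ('X * ('X * y)^`() * psi_pow (a - 1))).
Proof.
rewrite /psi_pow deriv_comp.
(* Differentiating the truncated series loses its coefficient of degree N, whence the correction
   term in ['X^N]. *)
have -> : (\poly_(r < N.+1) gbinom a r)^`() =
  a *: \poly_(r < N.+1) gbinom (a - 1) r - (a * gbinom (a - 1) N) *: 'X^N.
  apply/polyP => i; rewrite coef_deriv coefB !coefZ !coef_poly coefXn !ltnS.
  case: ltngtP => [lt_iN|_|->]; rewrite ?(ltnW lt_iN).
  - by rewrite -[LHS]mulr_natl gbinomS mulr0 subr0.
  - by rewrite mul0rn !mulr0 subr0.
  - by rewrite mul0rn mulr1 subrr.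
rewrite comp_polyB !comp_polyZ comp_Xn_poly mulrBl mulrBr rmorphB /=.
set c := a * _; set p := _ \Po _; set d := _^`().
(* After substitution the correction is a multiple of X (X y)^N, hence of X^(N+1). *)
have -> : tser ('X * (c *: ('X * y) ^+ N * d)) = 0.
  rewrite exprMn -scalerAl -scalerAr -!mulrA [y ^+ N * _]mulrC mulrA -exprS.
  by rewrite -mul_polyC mulrCA rmorphM rmorphXn /= tserXn_eq0 mul0r.
by rewrite subr0 -scalerAl -scalerAr; congr (tser (_ *: _)); rewrite -mulrA [p * d]mulrC.
Qed.

(* Lagrange's formula: the coefficient of t^n in p(U(t)), where U = t psi(U)^(1/h). *)
Definition lagrange_coef n (p : {poly K}) : K :=
  if n is n'.+1 then ('X * p^`() * psi_pow (n%:R / h%:R))`_n / n%:R else p`_0.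

Lemma lagrange_coefXn i n :
  (n <= N)%N -> lagrange_coef n 'X^i = ufactor K h i n.
Proof.
case: n => [|n] le_nN; first by rewrite /ufactor /= coefXn; case: i.
rewrite /ufactor /lagrange_coef andbF orbF derivXn.
case: i => [|i] /=; first by rewrite mulr0n mulr0 mul0r coef0 mul0r.
rewrite mulrnAr -exprS mulrnAl coefMn -[_ *+ i.+1]mulr_natl mulrAC; congr (_ * _).
rewrite coefXnM subzSS; case: ltnP => [lt_ni|le_in].
  (* For i > n both sides vanish: the power X^i starts too high, and [binomm] is 0 at a negative
     index. *)
  have -> : n%:Z - i%:Z = Negz (i - n).-1.
    by rewrite NegzE prednK ?subn_gt0 // -subzn ?opprB // ltnW.
  by [].
by rewrite subzn // -coef_psi_pow // (leq_trans (leq_subr _ _)) // ltnW.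
Qed.

(** The derivative alone would lose one order of precision; the factor X in X p' restores it. *)
Lemma lagrange_coef_tser n p q : (n <= N)%N ->
  tser p = tser q -> lagrange_coef n p = lagrange_coef n q.
Proof.
move=> le_nN /tserP e; case: n le_nN => [|n] le_nN; first exact: e.
rewrite /lagrange_coef; congr (_ / _); set w := psi_pow _.
have /tserP -> // : tser ('X * p^`() * w) = tser ('X * q^`() * w).
rewrite rmorphM [RHS]rmorphM /=; congr (_ * _); apply/tserP => i le_iN.
by rewrite !coefXderiv e.
Qed.

(* With g = X psi^(-1/h), the compositional inverse of U, this says (g p)(U(t)) = t p(U(t)). *)
Lemma lagrange_coef_shift n p : (n < N)%N ->
  lagrange_coef n.+1 ('X * psi_pow (- h%:R^-1) * p) = lagrange_coef n p.
Proof.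
move=> lt_nN; have hn0 : h%:R != 0 :> K by rewrite pnatr_eq0 -lt0n.
set Q := psi_pow _; rewrite {1}/lagrange_coef; set b := _ / _.
case: n lt_nN @b => [|n] lt_nN b /=.
  rewrite divr1 -mulrA coefXM /= -mulrA derivM derivX mul1r.
  rewrite !coefM !big_ord1 coefD coefXM addr0 coefM big_ord1.
  by rewrite !coef0_psi_pow mul1r mulr1.
set a : K := n.+1%:R / h%:R.
(* Product rule, with b - 1/h = a: here Q psi^b = psi^a, and X Q' psi^b = -(1/h) X psi' psi^(a-1) =
   -(1/(n+1)) X (psi^a)'. *)
have -> : ('X * ('X * Q * p)^`() * psi_pow b)`_n.+2 =
  (psi_pow a * p - n.+1%:R^-1 *: ('X * (psi_pow a)^`() * p) + 'X * p^`() * psi_pow a)`_n.+1.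
  rewrite -mulrA coefXM /=.
  have /tserP -> // : tser (('X * Q * p)^`() * psi_pow b) = tser (psi_pow a * p
    - n.+1%:R^-1 *: ('X * (psi_pow a)^`() * p) + 'X * p^`() * psi_pow a); last exact: ltnW.
  have eA : b - h%:R^-1 = a by rewrite /a /b -[n.+2%:R]natr1 mulrDl mul1r addrK.
  have e1 : tser (Q * psi_pow b) = tser (psi_pow a).
    by rewrite psi_powD addrC eA.
  have e2 : tser ('X * Q^`() * psi_pow b) = tser (- n.+1%:R^-1 *: ('X * (psi_pow a)^`())).
    have n0 : n.+1%:R != 0 :> K by rewrite pnatr_eq0.
    rewrite -mul_polyC.
    rewrite rmorphM [RHS]rmorphM /= /Q !Xderiv_psi_pow -!rmorphM /=.
    rewrite mul_polyC scalerA -scalerAl -2!mul_polyC [LHS]rmorphM [RHS]rmorphM /=.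
    have -> : - n.+1%:R^-1 * a = - h%:R^-1 :> K by rewrite /a mulNr mulKf.
    congr (_ * _); rewrite -(mulrA ('X * _)) rmorphM [RHS]rmorphM /=; congr (_ * _).
    by rewrite psi_powD; congr (tser (psi_pow _)); rewrite -eA; ring.
  rewrite !derivM derivX mul1r.
  have -> : ((Q + 'X * Q^`()) * p + 'X * Q * p^`()) * psi_pow b =
    (Q * psi_pow b) * p + 'X * Q^`() * psi_pow b * p + 'X * p^`() * (Q * psi_pow b).
    by ring.
  rewrite scalerAl -mulNr -scaleNr.
  by rewrite !rmorphD ![_ (_ * p)]rmorphM ![_ ('X * p^`() * _)]rmorphM /= e1 e2.
rewrite coefD coefB coefZ.
(* Since X d/dX multiplies the coefficient of degree n+1 by n+1, this gives (n+1) u = v + c with c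
   the coefficient of X p' psi^a. So u - v/(n+1) + c = c (n+2)/(n+1), and dividing by n+2 leaves
   c/(n+1). *)
have e3 : ('X * (psi_pow a * p)^`())`_n.+1 =
    ('X * (psi_pow a)^`() * p)`_n.+1 + ('X * p^`() * psi_pow a)`_n.+1.
  by rewrite derivM -coefD mulrDr [psi_pow a * _]mulrC !mulrA.
move: e3; rewrite coefXderiv.
set u := (psi_pow a * p)`_ _; set v := ('X * (psi_pow a)^`() * p)`_ _ => e3.
have n0 : 1 + n%:R != 0 :> K by rewrite nat1r pnatr_eq0.
have n1 : 2 + n%:R != 0 :> K by rewrite -natrD pnatr_eq0.
have -> : v = n.+1%:R * u - ('X * p^`() * psi_pow a)`_n.+1 by rewrite mulr_natl e3 addrK.
by field; rewrite n0 n1.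
Qed.

Fact lagrange_coef_is_linear n : linear_for *%R (lagrange_coef n).
Proof.
move=> u p q; case: n => [|n]; rewrite /lagrange_coef; first by rewrite coefD coefZ.
rewrite linearP mulrDr mulrDl -scalerAr -scalerAl coefD coefZ.
by rewrite mulrDl mulrA.
Qed.

(** This is p(U(c t)) modulo t^(N+1); c will be an h-th root of unity. *)
Definition lagrange_series (c : K) (p : {poly K}) : tseries K N :=
  tser (\poly_(n < N.+1) (lagrange_coef n p * c ^+ n)).

Lemma tcoef_lagrange_series c p n :
  (n <= N)%N -> tcoef n (lagrange_series c p) = lagrange_coef n p * c ^+ n.
Proof. by move=> le_nN; rewrite tcoef_tser le_nN coef_poly ltnS le_nN. Qed.

Lemma lagrange_series_tser c p q :
  tser p = tser q -> lagrange_series c p = lagrange_series c q.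
Proof.
move=> e; apply/tseriesP => n le_nN; rewrite !tcoef_lagrange_series //.
by rewrite (lagrange_coef_tser le_nN e).
Qed.

Lemma lagrange_seriesP c u p q :
  lagrange_series c (u *: p + q) = tser u%:P * lagrange_series c p + lagrange_series c q.
Proof.
rewrite -rmorphM -rmorphD /=; congr (tser _); apply/polyP => n.
rewrite coefD coefCM !coef_poly; case: ifP => _; last by rewrite mulr0 addr0.
by rewrite lagrange_coef_is_linear mulrDl -mulrA.
Qed.

Lemma lagrange_series1 c : lagrange_series c 1 = 1.
Proof.
rewrite -(rmorph1 tser); apply/tserP => -[|n] le_nN.
  by rewrite coef_poly /= mulr1.
rewrite coef_poly ltnS le_nN /= (_ : 1 = 1%:P) // derivC mulr0 mul0r coef0.
by rewrite !mul0r coefC.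
Qed.

Fact lagrange_series_is_zmod_morphism c : zmod_morphism (lagrange_series c).
Proof.
move=> p q; rewrite -[p - q]addrC -scaleN1r lagrange_seriesP !rmorphN !rmorph1.
by rewrite mulN1r addrC.
Qed.
HB.instance Definition _ c := GRing.isZmodMorphism.Build {poly K} (tseries K N)
  (lagrange_series c) (lagrange_series_is_zmod_morphism c).

Lemma lagrange_series_shift c p :
  lagrange_series c ('X * psi_pow (- h%:R^-1) * p) =
  tser c%:P * (tser 'X * lagrange_series c p).
Proof.
rewrite [in RHS]/lagrange_series -!tserM; apply/tserP => n le_nN.
rewrite coefCM coefXM !coef_poly ltnS le_nN; case: n le_nN => [|n] le_nN /=.
  by rewrite -mulrA coefXM mul0r mulr0.
by rewrite ltnS (ltnW le_nN) -/(lagrange_coef n.+1 _) lagrange_coef_shift // exprS mulrCA.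
Qed.

Lemma psi_pow_inv : tser (psi_pow (- h%:R^-1) * psi_pow h%:R^-1) = 1.
Proof. by rewrite psi_powD addNr psi_pow0 rmorph1. Qed.

(* Writing q = q_0 + X q' and X = g psi^(1/h), the shift lemma shows that the defect
   (p q)(U) - p(U) q(U) is c t times the same defect for p and psi^(1/h) q', hence is divisible
   by every power of t. *)
Lemma lagrange_seriesM c p q :
  lagrange_series c (p * q) = lagrange_series c p * lagrange_series c q.
Proof.
suff div_tk k : exists e, lagrange_series c (p * q) - lagrange_series c p * lagrange_series c q =
    tser 'X ^+ k * e.
  by apply/subr0_eq; have [e ->] := div_tk N.+1; rewrite tserXn_eq0 mul0r.
elim: k q => [|k IHk] q; first by eexists; rewrite mul1r.
elim/poly_ind: q => [|q u _].
  by exists 0; rewrite !mulr0 raddf0 mulr0 subr0.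
have [e IHe] := IHk (psi_pow h%:R^-1 * q); exists (tser c%:P * e).
have eX r : lagrange_series c (r * (q * 'X)) =
    tser c%:P * (tser 'X * lagrange_series c (r * (psi_pow h%:R^-1 * q))).
  rewrite -lagrange_series_shift; apply: lagrange_series_tser.
  transitivity (tser ('X * r * q * (psi_pow (- h%:R^-1) * psi_pow h%:R^-1))).
    by rewrite [RHS]tserM psi_pow_inv mulr1; congr tser; ring.
  by congr tser; ring.
have eu r : lagrange_series c (r * (q * 'X + u%:P)) = tser u%:P * lagrange_series c r +
    tser c%:P * (tser 'X * lagrange_series c (r * (psi_pow h%:R^-1 * q))).
  by rewrite mulrDr addrC -[r * u%:P]mulrC mul_polyC lagrange_seriesP eX.
rewrite eu -[q * 'X + _]mul1r eu lagrange_series1 mul1r.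
have -> : lagrange_series c (p * (psi_pow h%:R^-1 * q)) = tser 'X ^+ k * e +
    lagrange_series c p * lagrange_series c (psi_pow h%:R^-1 * q).
  by rewrite -IHe subrK.
by rewrite exprS; ring.
Qed.

Lemma lagrange_seriesXn c p n :
  lagrange_series c (p ^+ n) = lagrange_series c p ^+ n.
Proof.
by elim: n => [|n IHn]; rewrite ?lagrange_series1 // !exprS lagrange_seriesM IHn.
Qed.

(* U(c t) / t. *)
Definition reduced_root (c : K) : tseries K N :=
  tser c%:P * lagrange_series c (psi_pow h%:R^-1).

(** Write X = (X psi^(-1/h)) psi^(1/h); the shift lemma turns the first factor into c t. *)
Lemma reduced_rootE c : tser 'X * reduced_root c = lagrange_series c 'X.
Proof.
rewrite /reduced_root mulrCA -lagrange_series_shift; apply: lagrange_series_tser.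
by rewrite -mulrA tserM psi_pow_inv mulr1.
Qed.

Lemma tcoef0_reduced_root c : tcoef 0 (reduced_root c) = c.
Proof.
rewrite /reduced_root -tserM tcoef_tser /= coefCM coef_poly /= coef0_psi_pow.
by rewrite !mulr1.
Qed.

(** This is U^h = (c t)^h psi(U) divided by t^h: since evaluation at U(c t) is multiplicative, the
    h-th power of psi^(1/h)(U) is psi(U), and c^h = 1 disappears. *)
Lemma reduced_root_eq c : c ^+ h = 1 ->
  reduced_root c ^+ h = \sum_(i < (2 * h).+1) (tser 'X * reduced_root c) ^+ i.
Proof.
move=> ch1; under eq_bigr do rewrite reduced_rootE -lagrange_seriesXn.
rewrite -raddf_sum /reduced_root exprMn -rmorphXn -polyC_exp ch1 rmorph1 mul1r.
rewrite -lagrange_seriesXn; apply: lagrange_series_tser.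
by rewrite -psi_pow1 rmorphXn psi_powMn -[_ *+ h]mulr_natr mulVf ?pnatr_eq0 -?lt0n.
Qed.

Lemma tcoef_root_exp c i n : (n <= N)%N ->
  tcoef n ((tser 'X * reduced_root c) ^+ i) = ufactor K h i n * c ^+ n.
Proof.
move=> le_nN; rewrite reduced_rootE -lagrange_seriesXn tcoef_lagrange_series //.
by rewrite lagrange_coefXn.
Qed.

End LagrangeInversion.

(** * Complete symmetric polynomials and the kernel *)

Lemma coef_prod_ffun (R : comNzRingType) h (p : 'I_h -> {poly R}) m M : (m <= M)%N ->
  (\prod_j p j)`_m =
  \sum_(f : {ffun 'I_h -> 'I_M.+1} | (\sum_j (f j : nat) == m)%N) \prod_j (p j)`_(f j).
Proof.
move=> le_mM.
(* Cutting each factor above degree M leaves the coefficient of degree m unchanged, and makes the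
   product a product of finite sums. *)
have -> : (\prod_j p j)`_m = (\prod_j (\poly_(i < M.+1) (p j)`_i))`_m.
  elim: (index_enum _) m le_mM => [|j s IHs] m le_mM; first by rewrite !big_nil.
  rewrite !big_cons !coefM; apply: eq_bigr => i _.
  have le_iM : (i <= M)%N by apply: leq_trans le_mM; rewrite -ltnS.
  by rewrite coef_poly ltnS le_iM IHs // (leq_trans (leq_subr _ _)).
under eq_bigr do rewrite poly_def.
rewrite bigA_distr_bigA coef_sum [RHS]big_mkcond; apply: eq_bigr => f _.
by rewrite scaler_prod prodrXr coefZ coefXn eq_sym; case: eqP; rewrite ?mulr1 ?mulr0.
Qed.

(** The complete homogeneous symmetric polynomial of degree k; no exponent can exceed k. *)
Definition hsym (R : comNzRingType) h (V : 'I_h -> R) (k : nat) : R :=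
  \sum_(f : {ffun 'I_h -> 'I_k.+1} | (\sum_j (f j : nat) == k)%N) \prod_j V j ^+ f j.

(** Both sides are the coefficient of X^k in the product of the truncated geometric series of the
    V_j. A common exponent bound lets several degrees be compared. *)
Lemma hsym_widen (R : comNzRingType) h (V : 'I_h -> R) k M : (k <= M)%N ->
  hsym V k = \sum_(f : {ffun 'I_h -> 'I_M.+1} | (\sum_j (f j : nat) == k)%N) \prod_j V j ^+ f j.
Proof.
move=> le_kM; pose p j := \poly_(i < M.+1) V j ^+ i.
have pE m (le_mM : (m <= M)%N) (f : {ffun 'I_h -> 'I_m.+1}) :
    \prod_j (p j)`_(f j) = \prod_j V j ^+ f j.
  by apply: eq_bigr => j _; rewrite coef_poly (leq_trans (ltn_ord _)).
transitivity (\prod_j p j)`_k.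
  by rewrite (coef_prod_ffun _ (leqnn k)); apply: eq_bigr => f _; rewrite pE.
by rewrite (coef_prod_ffun _ le_kM); apply: eq_bigr => f _; rewrite pE.
Qed.

(** In a ring with zero divisors, distinct roots do not suffice to split off linear factors; unit
    differences do. *)
Lemma uniq_roots_map (R : comUnitRingType) (I : eqType) (F : I -> R) (s : seq I) :
  uniq s -> {in s &, forall i j, i != j -> F j - F i \is a GRing.unit} ->
  uniq_roots (map F s).
Proof.
elim: s => //= i s IHs /andP[i_s us] Fs; rewrite IHs ?andbT //; last first.
  by move=> j k js ks; apply: Fs; rewrite inE ?js ?ks orbT.
apply/allP => _ /mapP[j js ->]; rewrite /diff_roots mulrC eqxx Fs ?inE ?eqxx ?js ?orbT //.
by apply: contraNneq i_s => ->.
Qed.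

(* The reversed kernel has all the 1/V_j among its roots, so multiplying it by the generating
   function of the complete symmetric polynomials leaves a polynomial of degree at most h. *)
Lemma hsym_kernel (R : comUnitRingType) h (V : 'I_h -> R) (t : R) k :
  (0 < h)%N -> (forall j, V j \is a GRing.unit) ->
  (forall i j, i != j -> V i - V j \is a GRing.unit) ->
  (forall j, V j ^+ h = \sum_(i < (2 * h).+1) (t * V j) ^+ i) ->
  (0 < k)%N ->
  hsym V k = \sum_(i < (2 * h).+1 | (h <= k + i)%N) t ^+ i * hsym V (k + i - h).
Proof.
move=> h_gt0 uV uVV eV k_gt0.
(* With the kernel K(x) = x^h - sum of (t x)^i, this is X^(2h) K(1/X). *)
pose P : {poly R} := 'X^h - \sum_(i < (2 * h).+1) t ^+ i *: 'X^(2 * h - i).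
have rootP j : root P (V j)^-1.
  rewrite rootE !hornerE horner_sum subr_eq0; apply/eqP.
  apply: (@mulIr _ (V j ^+ (2 * h))); first exact: unitrX.
  rewrite mulr_suml exprVn {1}mul2n -addnn exprD mulKr ?unitrX // eV.
  apply: eq_bigr => i _; rewrite hornerZ hornerXn exprMn -mulrA; congr (_ * _).
  have -> : V j ^+ (2 * h) = V j ^+ (2 * h - i) * V j ^+ i by rewrite -exprD subnK // -ltnS.
  by rewrite exprVn mulKr // unitrX.
have [q defP] : exists q, P = q * \prod_j ('X - ((V j)^-1)%:P).
  have [||q ->] := @uniq_roots_prod_XsubC R P [seq (V j)^-1 | j <- enum 'I_h].
  - by apply/allP => _ /mapP[j _ ->].
  - apply: uniq_roots_map; rewrite ?enum_uniq // => i j _ _ ne_ij.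
    have -> : (V j)^-1 - (V i)^-1 = (V j)^-1 * (V i)^-1 * (V i - V j).
      by rewrite mulrBr -mulrA mulVr // mulr1 mulrAC mulVr // mul1r.
    by rewrite !unitrM !unitrV !uV uVV.
  by exists q; rewrite big_map big_enum.
have szq : (size q <= h.+1)%N.
  have [->|nz_q] := eqVneq q 0; first by rewrite size_poly0.
  have szP : (size P <= (2 * h).+1)%N.
    rewrite (leq_trans (size_polyD _ _)) // geq_max size_polyXn ltnS leq_pmull //=.
    rewrite size_polyN (leq_trans (size_sum _ _ _)) //; apply/bigmax_leqP => i _.
    by rewrite (leq_trans (size_scale_leq _ _)) // size_polyXn ltnS leq_subr.
  move: szP; rewrite defP size_Mmonic ?monic_prod_XsubC //.
  by rewrite -big_enum size_prod_XsubC size_enum_ord addnS /= mul2n -addnn -addSn leq_add2r.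
(* Degree h + k is the only one inspected below, so the geometric series may be cut there. *)
pose M := (h + k)%N; pose S := \prod_j \poly_(i < M.+1) V j ^+ i.
have coefS m : (m <= M)%N -> S`_m = hsym V m.
  move=> le_mM; rewrite (hsym_widen _ le_mM) (coef_prod_ffun _ le_mM).
  by apply: eq_bigr => f _; apply: eq_bigr => j _; rewrite coef_poly ltn_ord.
have PS0 : (P * S)`_(h + k) = 0.
  have coefqS : (q * \prod_j ('X - ((V j)^-1)%:P) * S)`_(h + k) = (q * (\prod_j - (V j)^-1)%:P)`_(h + k).
    rewrite -mulrA -big_split /=.
    (* Each linear factor telescopes against its geometric series, leaving a constant and a
       remainder in X^(M+1), beyond the inspected degree. *)
    have -> : \prod_(j < h) (('X - ((V j)^-1)%:P) * \poly_(i < M.+1) V j ^+ i) =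
        \prod_(j < h) (- (V j)^-1)%:P * \prod_(j < h) (1 - (V j)%:P ^+ M.+1 * 'X^(M.+1)).
      rewrite -big_split; apply: eq_bigr => j _ /=; rewrite poly_def.
      have -> : 'X - ((V j)^-1)%:P = (- (V j)^-1)%:P * (1 - (V j)%:P * 'X).
        by rewrite mulrBr mulr1 mulrA -polyCM mulNr mulVr // !polyCN mulN1r opprK addrC.
      rewrite -mulrA; congr (_ * _); rewrite -exprMn -[in RHS](expr1n _ M.+1) subrXX; congr (_ * _).
      by apply: eq_bigr => i _; rewrite expr1n mul1r exprMn -polyC_exp mul_polyC.
    have [r ->] : exists r, \prod_(j < h) (1 - (V j)%:P ^+ M.+1 * 'X^(M.+1)) = 1 + 'X^(M.+1) * r.
      apply: (big_ind (fun p => exists r, p = 1 + 'X^(M.+1) * r)).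
      - by exists 0; rewrite mulr0 addr0.
      - by move=> _ _ [r1 ->] [r2 ->]; exists (r1 + r2 + 'X^(M.+1) * r1 * r2); ring.
      - by move=> j _; exists (- (V j)%:P ^+ M.+1); ring.
    rewrite -rmorph_prod /=; set C := (\prod_(j < h) _)%:P.
    have -> : q * (C * (1 + 'X^(M.+1) * r)) = q * C + 'X^(M.+1) * (q * C * r) by ring.
    by rewrite coefD coefXnM ltnSn addr0.
  (* The degree of q is at most h, below h + k because k > 0. *)
  by rewrite defP coefqS coefMC nth_default ?mul0r // (leq_trans szq) //; lia.
(* In degree h + k, the term X^h of P contributes h_k and the term t^i X^(2h-i) contributes t^i
   h_(k+i-h), or nothing when k + i < h. *)
move: PS0; rewrite mulrBl coefB coefXnM ltnNge leq_addr addKn coefS ?leq_addl //.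
move/eqP; rewrite subr_eq0 => /eqP ->.
rewrite mulr_suml coef_sum [RHS]big_mkcond; apply: eq_bigr => i _.
have lt_i := ltn_ord i; rewrite -scalerAl coefZ coefXnM.
have -> : (h + k < 2 * h - i)%N = ~~ (h <= k + i)%N by lia.
case: ifP => /= [|le_hki]; [by rewrite mulr0 => /negbTE -> | ].
have {}le_hki : (h <= k + i)%N by lia.
by rewrite le_hki coefS; [congr (_ * hsym V _) | ]; lia.
Qed.

(** * Decomposition of walks by their last step *)

Section Walks.
Variable h : nat.
Local Notation T := 'I_(2 * h).+1.

Definition walk_rcons n (s : {ffun 'I_n -> T}) (x : T) : {ffun 'I_n.+1 -> T} :=
  [ffun i : 'I_n.+1 => if insub (i : nat) is Some j then s j else x].

Lemma walk_rcons_widen n (s : {ffun 'I_n -> T}) x (j : 'I_n) :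
  walk_rcons s x (widen_ord (leqnSn n) j) = s j.
Proof. by rewrite ffunE valK. Qed.

Lemma walk_rcons_max n (s : {ffun 'I_n -> T}) x : walk_rcons s x ord_max = x.
Proof. by rewrite ffunE insubF //= ltnn. Qed.

Lemma altitude_rcons n (s : {ffun 'I_n -> T}) x i : (i <= n)%N ->
  altitude (walk_rcons s x) i = altitude s i.
Proof.
move=> le_in; rewrite /altitude big_mkcond big_ord_recr /= ltnNge le_in addr0.
by rewrite [RHS]big_mkcond; apply: eq_bigr => j _; rewrite walk_rcons_widen.
Qed.

Lemma altitude_rcons_last n (s : {ffun 'I_n -> T}) x :
  altitude (walk_rcons s x) n.+1 = altitude s n + step x.
Proof.
rewrite /altitude big_mkcond big_ord_recr /= ltnSn walk_rcons_max; congr (_ + _).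
rewrite [RHS]big_mkcond; apply: eq_bigr => j _.
by rewrite walk_rcons_widen /= ltn_ord ltnS ltnW.
Qed.

Lemma positive_walk_rcons n (s : {ffun 'I_n -> T}) x :
  positive_walk (walk_rcons s x) = positive_walk s && (1 <= altitude s n + step x).
Proof.
apply/forallP/andP => [pos|[/forallP pos pos_last] i].
  split; last by have /implyP/(_ isT) := pos ord_max; rewrite /= altitude_rcons_last.
  apply/forallP => i; have := pos (widen_ord (leqnSn _) i).
  by rewrite /= altitude_rcons // -ltnS.
have := ltn_ord i; rewrite ltnS leq_eqVlt => /predU1P[->|lt_in].
  by rewrite altitude_rcons_last pos_last.
by have := pos (Ordinal lt_in); rewrite /= altitude_rcons.
Qed.

Lemma num_pos_walksS n (k : int) : 1 <= k ->
  num_pos_walks h n.+1 k = (\sum_(x : T) num_pos_walks h n (k - step x)%R)%N.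
Proof.
move=> k_ge1; rewrite /num_pos_walks -sum1dep_card.
(* A walk of length n + 1 corresponds to its prefix and last step. Ending at k >= 1 already makes
   the last point positive, so only the prefix remains constrained. *)
rewrite (reindex (fun p : {ffun 'I_n -> T} * T => walk_rcons p.1 p.2)) /=; last first.
  exists (fun s => ([ffun j => s (widen_ord (leqnSn n) j)], s ord_max)).
    move=> [s x] _ /=; rewrite walk_rcons_max; congr (_, _).
    by apply/ffunP => j; rewrite ffunE walk_rcons_widen.
  move=> s _ /=; apply/ffunP => i; rewrite ffunE; case: insubP => [j _ eq_ji | ].
    by rewrite ffunE; congr (s _); apply: val_inj.
  by rewrite -leqNgt => le_ni; congr (s _); apply/val_inj/eqP; rewrite eqn_leq le_ni -ltnS ltn_ord.
transitivity (\sum_(p : {ffun 'I_n -> T} * T | positive_walk p.1 && (altitude p.1 n == k - step p.2)%R) 1)%N.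
  apply: eq_bigl => -[s x] /=; rewrite positive_walk_rcons altitude_rcons_last.
  rewrite [_ + _ == k]eq_sym -subr_eq [k - _ == _]eq_sym -andbA.
  by case: eqP => [->|_]; rewrite ?andbF // subrK k_ge1.
rewrite -(pair_big_dep xpredT (fun s x => positive_walk s && (altitude s n == k - step x)) (fun _ _ => 1%N)) /=.
rewrite (exchange_big_dep xpredT) //=; apply: eq_bigr => x _.
by rewrite sum1dep_card.
Qed.

Lemma num_pos_walksS_le0 n (k : int) : k <= 0 -> num_pos_walks h n.+1 k = 0%N.
Proof.
move=> k_le0; apply: eq_card0 => s; rewrite !inE; apply/negbTE/negP => /andP[/forallP/(_ ord_max)].
rewrite /= => pos /eqP alt; rewrite alt in pos.
by have := le_trans pos k_le0.
Qed.

Lemma num_pos_walks0 (k : int) : num_pos_walks h 0 k = (k == 0).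
Proof.
have alt0 (s : {ffun 'I_0 -> T}) i : altitude s i = 0 by rewrite /altitude big_ord0.
case: eqP => [->|/eqP nz_k].
  rewrite /num_pos_walks (_ : [set s | _] = setT) ?cardsT ?card_ffun ?card_ord ?expn0 //.
  apply/setP => s; rewrite !inE alt0 eqxx andbT; apply/forallP => i.
  by rewrite (ord1 i).
by apply: eq_card0 => s; rewrite !inE alt0 eq_sym (negbTE nz_k) andbF.
Qed.

Lemma altitude_le n (s : {ffun 'I_n -> T}) i : altitude s i <= (n * h)%:Z.
Proof.
have le_step (x : T) : step x <= h%:Z.
  by rewrite /step lerBlDr -PoszD lez_nat addnn -mul2n -ltnS ltn_ord.
have -> : (n * h)%:Z = \sum_(j < n) h%:Z by rewrite sumr_const card_ord -mulr_natl natz.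
by rewrite [leLHS]big_mkcond; apply: ler_sum => j _; case: ifP.
Qed.

Lemma altitude_last_ge0 n (s : {ffun 'I_n -> T}) : positive_walk s -> 0 <= altitude s n.
Proof.
move=> /forallP/(_ ord_max) /=; case: n s => [|n] s; first by rewrite /altitude big_ord0.
by rewrite /= => pos; apply: le_trans pos.
Qed.

Lemma num_pos_meandersE n :
  num_pos_meanders h n = (\sum_(k < (n * h).+1) num_pos_walks h n (k : nat)%:Z)%N.
Proof.
rewrite /num_pos_meanders -sum1dep_card.
(* [inord] is faithful here, as a positive walk ends between 0 and n h; altitude 0 occurs only for
   the empty walk. *)
rewrite (partition_big (fun s => inord `|altitude s n|%N : 'I_(n * h).+1) xpredT) //=.
apply: eq_bigr => k _; rewrite sum1dep_card; apply: eq_card => s; rewrite !inE.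
case pos: (positive_walk s) => //=; rewrite -val_eqE /=.
have := altitude_le s n; have := altitude_last_ge0 pos.
case: (altitude s n) => // a _; rewrite lez_nat => le_a.
by rewrite inordK.
Qed.

End Walks.

(** * The kernel method over a field containing the roots of unity *)

Lemma tcoef_prod_ffun (K : fieldType) N h (a : 'I_h -> tseries K N) m : (m <= N)%N ->
  tcoef m (\prod_j a j) =
  \sum_(f : {ffun 'I_h -> 'I_m.+1} | (\sum_j (f j : nat) == m)%N) \prod_j tcoef (f j) (a j).
Proof.
move=> le_mN; have [p ap] : exists p : 'I_h -> {poly K}, forall j, a j = tser N (p j).
  exists (fun j => polyn (a j)) => j.
  by apply/tseriesP => i le_iN; rewrite tcoef_tser le_iN.
under eq_bigr do rewrite ap.
rewrite -rmorph_prod /= tcoef_tser le_mN (coef_prod_ffun _ (leqnn m)).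
apply: eq_bigr => f _; apply: eq_bigr => j _.
by rewrite ap tcoef_tser (leq_trans _ le_mN) // -ltnS.
Qed.

Section KernelMethod.
Variables (K : numFieldType) (h : nat) (w : K).
Hypotheses (h_gt0 : (0 < h)%N) (wh1 : w ^+ h = 1).
Hypothesis w_inj : forall i j : 'I_h, i != j -> w ^+ i != w ^+ j.

Let V N (j : 'I_h) : tseries K N := reduced_root h N (w ^+ j).

(** Length n is read at t^(n h) because z = t^h. In the induction on n, removing the last step
    matches [hsym_kernel]; the case k = 0 is included since steps may start at the origin, and there
    h_0 = 1 accounts for the empty walk alone. *)
Lemma num_pos_walks_hsym N n k : (n * h <= N)%N ->
  (num_pos_walks h n k%:Z)%:R = tcoef (n * h) (tser N 'X ^+ k * hsym (@V N) k).
Proof.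
have hsym0 : hsym (@V N) 0 = 1.
  rewrite /hsym (bigD1 [ffun=> ord0]) /=; last by rewrite big1 // => j _; rewrite ffunE.
  rewrite big1 => [|j _]; last by rewrite ffunE.
  rewrite big1 ?addr0 // => f /andP[_ /negP[]]; apply/eqP/ffunP => j.
  by rewrite [f j]ord1 ffunE.
have tcoef1 m : tcoef m (1 : tseries K N) = (m == 0%N)%:R.
  rewrite -(rmorph1 (@tser K N)) tcoef_tser coef1.
  by case: m => [|m] //=; rewrite if_same.
elim: n k => [|n IHn] k le_N.
  rewrite num_pos_walks0; case: k => [|k]; first by rewrite hsym0 mulr1 expr0 tcoef1.
  have [p ->] := tser_surj (hsym (@V N) k.+1).
  by rewrite -rmorphXn -tserM tcoef_tser /= coefXnM.
case: k => [|k].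
  rewrite num_pos_walksS_le0 // hsym0 mulr1 expr0 tcoef1.
  by rewrite muln_eq0 /= eqn0Ngt h_gt0.
have le_nN : (n * h <= N)%N by rewrite (leq_trans _ le_N) // leq_mul2r leqnSn orbT.
rewrite num_pos_walksS // (@hsym_kernel _ _ _ (tser N 'X)) //; first last.
- by move=> j; apply: reduced_root_eq => //; rewrite exprAC wh1 expr1n.
- move=> i j ne_ij; apply: tseries_unit; rewrite raddfB /= !tcoef0_reduced_root.
  by rewrite subr_eq0 w_inj.
- move=> j; apply: tseries_unit; rewrite tcoef0_reduced_root expf_neq0 //.
  by apply/eqP => w0; move/eqP: wh1; rewrite w0 expr0n eqn0Ngt h_gt0 eq_sym oner_eq0.
(* The index reversal pairs the kernel term i with the last step h - i, whose predecessor is at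
   altitude k + 1 + i - h. *)
rewrite natr_sum mulr_sumr raddf_sum /= [RHS]big_mkcond (reindex_inj rev_ord_inj) /=.
apply: eq_bigr => i _; have lt_i := ltn_ord i; case: leqP => le_hki.
  have -> : (k.+1)%:Z - step (rev_ord i) = (k.+1 + i - h)%N%:Z.
    by rewrite /step /=; lia.
  (* The powers of t combine as t^(k+1) t^i = t^h t^(k+1+i-h); the factor t^h accounts for the
     removed step. *)
  rewrite IHn // mulrA -exprD -[(k.+1 + i)%N](subnKC le_hki) addKn exprD -mulrA.
  by apply/esym/tcoefXnM; rewrite -mulSn.
(* The predecessor would be at a negative altitude, which no positive walk reaches. *)
have lt0 : (k.+1)%:Z - step (rev_ord i) < 0 by rewrite /step /=; lia.
case: n {IHn le_N le_nN} => [|n]; last by rewrite num_pos_walksS_le0 // ltW.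
by rewrite num_pos_walks0 lt_eqF.
Qed.

Definition walk_summand n M (ns : {ffun 'I_h -> 'I_n.+1}) (ii : {ffun 'I_h -> 'I_M.+1}) : K :=
  (\prod_(j < h) ufactor K h (ii j) (ns j)) * w ^+ (\sum_(j < h) (j : nat) * ns j)%N.

Lemma num_pos_walks_formula n k M : (k <= M)%N ->
  (num_pos_walks h n k%:Z)%:R =
  \sum_(ns : {ffun 'I_h -> 'I_(n * h).+1} | (\sum_(j < h) (ns j : nat) == n * h)%N)
    \sum_(ii : {ffun 'I_h -> 'I_M.+1} | (\sum_(j < h) (ii j : nat) == k)%N)
      walk_summand ns ii.
Proof.
move=> le_kM; rewrite (@num_pos_walks_hsym (n * h)) // (hsym_widen _ le_kM).
rewrite mulr_sumr raddf_sum /= exchange_big /=; apply: eq_bigr => ii /eqP sum_ii.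
rewrite -{1}sum_ii -prodrXr -big_split /= tcoef_prod_ffun //.
apply: eq_bigr => ns _; rewrite /walk_summand -prodrXr -big_split; apply: eq_bigr => j _ /=.
rewrite -exprMn tcoef_root_exp ?exprM //.
by rewrite -ltnS.
Qed.

(** Sum the walk formula over the final altitude k <= n h. If every i_j <= n_j, the sum of the i_j
    is at most n h and selects exactly one k; otherwise some i_j > n_j and the summand vanishes, as
    U^i starts at degree i. *)
Lemma num_pos_meanders_formula n :
  (num_pos_meanders h n)%:R =
  \sum_(ns : {ffun 'I_h -> 'I_(n * h).+1} | (\sum_(j < h) (ns j : nat) == n * h)%N)
    \sum_(ii : {ffun 'I_h -> 'I_(n * h).+1}) walk_summand ns ii.
Proof.
rewrite num_pos_meandersE natr_sum.
under eq_bigr => k _ do rewrite (@num_pos_walks_formula _ _ (n * h)) -1?ltnS //.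
rewrite exchange_big /=; apply: eq_bigr => ns /eqP sum_ns.
rewrite (exchange_big_dep xpredT) //=; apply: eq_bigr => ii _.
have [le_ii|lt_ns] := boolP [forall j, ii j <= ns j]%N.
  have lt_sum : (\sum_(j < h) ii j < (n * h).+1)%N.
    by rewrite ltnS (leq_trans (leq_sum _ _) (eq_leq sum_ns)) // => j _; apply: (forallP le_ii).
  rewrite (bigD1 (Ordinal lt_sum)) //= big1 ?addr0 // => k /andP[/eqP sum_ii /negP[]].
  by apply/eqP/val_inj.
suff -> : walk_summand ns ii = 0 by rewrite big1_eq.
have [j] := forallPn lt_ns; rewrite -ltnNge => lt_j.
rewrite /walk_summand (bigD1 j) //= (_ : ufactor _ _ _ _ = 0) ?mul0r //.
rewrite /ufactor; case: (ii j : nat) (ns j : nat) lt_j => [|i] // [|m] lt_mi //=.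
rewrite subzSS (_ : m%:Z - i%:Z = Negz (i - m).-1) ?mulr0 //.
by rewrite NegzE; lia.
Qed.
End KernelMethod.

(** * Specialization to complex roots of unity *)

(** The theorem computes these factors over the reals and embeds them, whereas the kernel method
    runs entirely over the complex numbers. *)
Lemma ufactor_rmorph (K L : fieldType) (f : {rmorphism K -> L}) h i n :
  f (ufactor K h i n) = ufactor L h i n.
Proof.
have fgbinom a r : f (gbinom a r) = gbinom (f a) r.
  rewrite /gbinom rmorphM fmorphV rmorph_nat rmorph_prod; congr (_ / _).
  by apply: eq_bigr => j _; rewrite rmorphB rmorph_nat.
rewrite /ufactor; case: ifP => _; first exact: rmorph1.
case: ifP => _; first exact: rmorph0.
rewrite !rmorphM !fmorphV !rmorph_nat; congr (_ * _).
case: (_ - _ : int) => m /=; last exact: rmorph0.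
rewrite rmorph_sum; apply: eq_bigr => r _ /=.
rewrite rmorphM fgbinom rmorphM fmorphV !rmorph_nat -coef_map rmorphXn rmorph_sum /=.
by under eq_bigr do rewrite map_polyXn.
Qed.

Lemma complex_cos_sinX (R : realType) (x : R) k :
  Complex (cos x) (sin x) ^+ k = Complex (cos (x *+ k)) (sin (x *+ k)).
Proof.
elim: k => [|k IHk]; first by rewrite mulr0n cos0 sin0.
rewrite exprS IHk mulrS cosD sinD [sin x * _ + _]addrC.
exact: erefl.
Qed.

Lemma omega_exp_h (R : realType) h : (0 < h)%N -> omega R h ^+ h = 1.
Proof.
move=> h_gt0; rewrite /omega complex_cos_sinX.
have -> : 2 * pi / h%:R *+ h = pi *+ 2 :> R.
  by rewrite -[LHS]mulr_natr mulfVK ?pnatr_eq0 -?lt0n // mulr_natl.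
by rewrite cos2pi sin2pi.
Qed.

Lemma omega_exp_neq1 (R : realType) h k : (0 < k < h)%N -> omega R h ^+ k != 1.
Proof.
case/andP=> k_gt0 lt_kh; rewrite /omega complex_cos_sinX; apply/eqP => -[cos1 _].
(* Half the angle of omega^k: x lies strictly between 0 and pi, so sin x > 0, while cos (2 x) = 1 -
   2 sin^2 x = 1 would force sin x = 0. *)
pose x : R := k%:R / h%:R * pi.
have h_gt0 : 0 < h%:R :> R by rewrite ltr0n (leq_trans _ lt_kh).
have sinx : 0 < sin x.
  apply: sin_gt0_pi; rewrite ?mulr_gt0 ?pi_gt0 ?invr_gt0 ?h_gt0 ?ltr0n //=.
  by rewrite gtr_pMl ?pi_gt0 // ltr_pdivrMr // mul1r ltr_nat.
have xE : 2 * pi / h%:R *+ k = x *+ 2 by rewrite -[LHS]mulr_natr /x; ring.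
rewrite xE in cos1; move: cos1; rewrite cos_mulr2n cos2sin2 => e.
have : sin x ^+ 2 = 0 by move: e; lra.
by move/eqP; rewrite sqrf_eq0 => /eqP e0; move: sinx; rewrite e0 ltxx.
Qed.

Lemma omega_exp_inj (R : realType) h (i j : 'I_h) :
  i != j -> omega R h ^+ i != omega R h ^+ j.
Proof.
wlog lt_ij : i j / (i < j)%N.
  move=> wl; case: (ltngtP i j) => [lt_ij|lt_ji|/val_inj->]; last by rewrite eqxx.
  - exact: wl.
  - by rewrite eq_sym [_ ^+ i == _]eq_sym; apply: wl.
move=> _; have w0 : omega R h != 0.
  apply/eqP => w0; have := @omega_exp_h R h (leq_ltn_trans (leq0n i) (ltn_ord i)).
  by rewrite w0 expr0n; case: (h) i {lt_ij} => [[]|h' _] //= /esym/eqP; rewrite oner_eq0.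
rewrite -(subnKC (ltnW lt_ij)) exprD -{1}[_ ^+ i]mulr1 (inj_eq (mulfI _)) ?expf_neq0 //.
rewrite eq_sym omega_exp_neq1 // subn_gt0 lt_ij /=.
exact: leq_ltn_trans (leq_subr _ _) (ltn_ord j).
Qed.

Local Open Scope complex_scope.

Theorem theorem4p6 (R : realType) (h : nat) (hh : (1 <= h)%N) :
  (forall (k n : nat), (1 <= k)%N ->
     (num_pos_walks h n k)%:R =
     \sum_(ns : {ffun 'I_h -> 'I_(n * h).+1} | (\sum_(j < h) (ns j : nat) == n * h)%N)
       \sum_(ii : {ffun 'I_h -> 'I_k.+1} | (\sum_(j < h) (ii j : nat) == k)%N)
         (\prod_(j < h) (@ufactor R h (ii j) (ns j))%:C)
           * omega R h ^+ (\sum_(j < h) (j : nat) * ns j)%N)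
  /\
  (forall n : nat,
     (num_pos_meanders h n)%:R =
     \sum_(ns : {ffun 'I_h -> 'I_(n * h).+1} | (\sum_(j < h) (ns j : nat) == n * h)%N)
       \sum_(ii : {ffun 'I_h -> 'I_(n * h).+1})
         (\prod_(j < h) (@ufactor R h (ii j) (ns j))%:C)
           * omega R h ^+ (\sum_(j < h) (j : nat) * ns j)%N).
Proof.
have w_h := omega_exp_h R hh; have w_inj := @omega_exp_inj R h.
have ufactorC i n : (ufactor R h i n)%:C = ufactor R[i] h i n by exact: ufactor_rmorph.
split=> [k n _ | n].
  rewrite (num_pos_walks_formula hh w_h w_inj _ (leqnn k)).
  apply: eq_bigr => ns _; apply: eq_bigr => ii _; congr (_ * _).
  by apply: eq_bigr => j _; rewrite ufactorC.
rewrite (num_pos_meanders_formula hh w_h w_inj).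
apply: eq_bigr => ns _; apply: eq_bigr => ii _; congr (_ * _).
by apply: eq_bigr => j _; rewrite ufactorC.
Qed.
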